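(* Let $D_1$ be an even delta-matroid having no singular elements and let $D_2$ be an even delta-matroid with non-singular element $e$. Then \[ Q(D_1\otimes_e D_2;w,x,t)=Q(D_1;q,p,t),\] where $(p,q)$ is the unique solution to the following system of linear equations in the ring $\mathbb Z[t,w,x]$: \begin{align*} Q(D_2/e;w,x,t)&=tp+q,\\ Q(D_2\backslash e;w,x,t)&=p+tq. \end{align*}
   Context: A delta-matroid is a pair $D=(E,\mathcal F)$ with $E$ a finite set (ground set, also written $E(D)$) and $\mathcal F$ a non-empty collection of subsets of $E$ (feasible sets) such that for all $X,Y\in\mathcal F$ and $u\in X\bigtriangleup Y$ there is $v\in X\bigtriangleup Y$ (possibly $v=u$) with $X\bigtriangleup\{u,v\}\in\mathcal F$. It is even if all feasible sets have cardinalities of the same parity. A coloop is an element in every feasible set; a loop is an element in no feasible set. An isomorphism of delta-matroids is a bijection of ground sets preserving feasible sets. An element $e$ is singular if it is a coloop, or a loop, or $F\bigtriangleup\{e\}$ is feasible for every feasible set $F$ (in an even delta-matroid, singular elements are exactly the loops and coloops). If $e$ is not a coloop, $D\backslash e=(E-\{e\},\{F\in\mathcal F:e\notin F\})$. If $e$ is not a loop, $D/e=(E-\{e\},\{F-\{e\}:F\in\mathcal F,\ e\in F\})$. If $e$ is a loop or coloop, whichever of $D\backslash e$, $D/e$ is so far undefined is set equal to the other. Two-sum of even delta-matroids: if $D_1=(E_1,\mathcal F_1)$, $D_2=(E_2,\mathcal F_2)$ are even with $E_1\cap E_2=\{f\}$ and $f$ non-singular in both, then $D_1\oplus_2 D_2$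 is the (even) delta-matroid with ground set $(E_1\cup E_2)-\{f\}$ and feasible sets $\{(F_1\cup F_2)-\{f\}:F_1\in\mathcal F_1,\ F_2\in\mathcal F_2,\ f\text{ belongs to exactly one of }F_1,F_2\}$. Tensor product: let $D_1$ be an even delta-matroid on $E_1$ in which every element is non-singular and $D_2$ an even delta-matroid with non-singular element $e$. Let $\{D_f:f\in E_1\}$ be delta-matroids with pairwise disjoint ground sets, $E_1\cap E(D_f)=\{f\}$ for every $f\in E_1$, and such that for each $f$ there is an isomorphism from $D_f$ to $D_2$ mapping $f$ to $e$. The tensor product $D_1\otimes_e D_2$ is the delta-matroid obtained from $D_1$ by successively forming the two-sum with $D_f$ along $f$ for every $f\in E_1$; the order does not matter and the result is determined up to isomorphism by $D_1$, $D_2$ and $e$. Transition polynomial of a delta-matroid $D=(E,\mathcal F)$: for formal variables $w,x,t$, \[Q(D;w,x,t)=\sum_{A\subseteq E}w^{|E-A|}x^{|A|}t^{d_D(A)},\qquad d_D(A)=\min_{F\in\mathcal F}|F\bigtriangleup A|.\] *)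

(* Defs.v *)
From HB Require Import structures.
From mathcomp Require Import all_boot all_order all_algebra.
From mathcomp Require Import mpoly.

Set Implicit Arguments.
Unset Strict Implicit.
Unset Printing Implicit Defensive.

Import GRing.Theory.
Local Open Scope ring_scope.

Definition symdiff (T : finType) (A B : {set T}) : {set T} :=
  (A :\: B) :|: (B :\: A).

(* The finite type T is only an ambient universe: the ground set is an
   arbitrary subset of T, so that several ground sets inside the same T may
   overlap or be disjoint. The axioms are in [delta_matroid]. *)
Record set_system (T : finType) := SetSystem {
  ground : {set T};
  feasible : {set {set T}}
}.

Section DeltaMatroids.
Variable T : finType.
Implicit Types (D : set_system T) (A F X Y : {set T}) (e f u v : T).

Definition delta_matroid D : Prop :=
  [/\ forall F, F \in feasible D -> F \subset ground D,
      feasible D != set0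
    & forall X Y u, X \in feasible D -> Y \in feasible D ->
        u \in symdiff X Y ->
        exists2 v, v \in symdiff X Y & symdiff X [set u; v] \in feasible D].

Definition even_system D : Prop :=
  {in feasible D &, forall F F', odd #|F| = odd #|F'|}.

Definition coloop D e : bool :=
  (e \in ground D) && [forall F in feasible D, e \in F].

Definition loop D e : bool :=
  (e \in ground D) && [forall F in feasible D, e \notin F].

Definition singular D e : bool :=
  [|| coloop D e, loop D e
    | (e \in ground D) &&
      [forall F in feasible D, symdiff F [set e] \in feasible D]].

Definition nonsingular D e : bool := (e \in ground D) && ~~ singular D e.

Definition delete_raw D e : set_system T :=
  SetSystem (ground D :\ e) [set F in feasible D | e \notin F].

Definition contract_raw D e : set_system T :=
  SetSystem (ground D :\ e) [set F :\ e | F in feasible D & e \in F].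

Definition delete D e : set_system T :=
  if coloop D e then contract_raw D e else delete_raw D e.

Definition contract D e : set_system T :=
  if loop D e then delete_raw D e else contract_raw D e.

(* Meaningful when ground D1 :&: ground D2 = [set f], both systems are even
   delta-matroids, and f is non-singular in both. *)
Definition two_sum f D1 D2 : set_system T :=
  SetSystem ((ground D1 :|: ground D2) :\ f)
    [set (F1 :|: F2) :\ f | F1 in feasible D1, F2 in feasible D2
                          & (f \in F1) (+) (f \in F2)].

(* The initial value #|ground D| of the minimum is irrelevant when D is a
   delta-matroid and A \subset ground D: then feasible D is non-empty and all
   the distances are at most #|ground D|. *)
Definition dist D A : nat :=
  \big[minn/#|ground D|]_(F in feasible D) #|symdiff F A|.

Definition transition (R : comNzRingType) D (w x t : R) : R :=
  \sum_(A in powerset (ground D))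
     w ^+ #|ground D :\: A| * x ^+ #|A| * t ^+ dist D A.

End DeltaMatroids.

Definition isomorphism (T T' : finType) (D : set_system T)
    (D' : set_system T') (phi : T -> T') : Prop :=
  [/\ {in ground D &, injective phi},
      phi @: ground D = ground D'
    & forall F : {set T}, F \subset ground D ->
        (F \in feasible D) = (phi @: F \in feasible D')].

(* [tensor_product D1 D2 e D]: D is obtained from D1 by successive two-sums
   with a family of copies Df f of D2, glued along f. The tensor product is
   only defined up to isomorphism, hence a relation; every choice of copies
   and every order s of the elements of E(D1) is allowed. *)
Definition tensor_product (T T2 : finType) (D1 : set_system T)
    (D2 : set_system T2) (e : T2) (D : set_system T) : Prop :=
  exists (Df : T -> set_system T) (s : seq T),
    [/\ {in ground D1, forall f,
           [/\ delta_matroid (Df f),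
               ground D1 :&: ground (Df f) = [set f]
             & exists2 phi : T -> T2,
                 isomorphism (Df f) D2 phi & phi f = e]},
        {in ground D1 &, forall f g, f != g ->
           [disjoint ground (Df f) & ground (Df g)]},
        perm_eq s (enum (ground D1))
      & D = foldl (fun D' f => two_sum f D' (Df f)) D1 s].

Definition var_t : {mpoly int[3]} := 'X_(@Ordinal 3 0 isT).
Definition var_w : {mpoly int[3]} := 'X_(@Ordinal 3 1 isT).
Definition var_x : {mpoly int[3]} := 'X_(@Ordinal 3 2 isT).

(* Main.v *)
Require Import Defs.
From HB Require Import structures.
From mathcomp Require Import all_boot all_order all_algebra.
From mathcomp Require Import mpoly.
From mathcomp Require Import zify ring.

Set Implicit Arguments.
Unset Strict Implicit.
Unset Printing Implicit Defensive.

Import GRing.Theory.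
Local Open Scope ring_scope.

(** For A in E(D2) - e put a = d(A + e) and b = d(A), distances being taken in D2.
    They are also the distances of A in D2/e and in D2\e: a nearest feasible set
    on the wrong side of e can be moved to the right side by one exchange, without
    getting further away. By evenness a and b have different parities, so
    |a - b| = 1. Hence p and q are the parts of the sum of w^|E - e - A| x^|A| t^min(a,b)
    over the A with b < a and with a < b respectively.
    In a two-sum along f, if the nearer side on the D2 part A2 is f not in F2 then
    the other part behaves as A1 + f at no extra cost, and as A1 otherwise. So
    summing over A2 replaces the weights of f in D1 by p (f chosen) and q (f not
    chosen). Giving every element its own pair of weights lets one iterate. *)

(** * Cardinalities of symmetric differences *)

Section Symdiff.
Local Open Scope nat_scope.
Variable T : finType.
Implicit Types (A B F G : {set T}) (f u v : T).

Lemma in_symdiff A B x : (x \in symdiff A B) = (x \in A) (+) (x \in B).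
Proof. by rewrite !inE; case: (x \in A); case: (x \in B). Qed.

Lemma odd_card_symdiff A B : odd #|symdiff A B| = odd #|A| (+) odd #|B|.
Proof.
have disjD : [disjoint A :\: B & B :\: A].
  by rewrite -setI_eq0; apply/eqP/setP=> x; rewrite !inE; do 2!case: (x \in _).
rewrite /symdiff cardsU (eqP (_ : _ :&: _ == set0)) ?setI_eq0 // cards0 subn0.
rewrite -(cardsID B A) -(cardsID A B) [B :&: A]setIC !oddD.
by do 3!case: (odd _).
Qed.

Lemma card_symdiffU1 f A F : f \notin A ->
  #|symdiff F (f |: A)| + (f \in F) = #|symdiff F A| + (f \notin F).
Proof.
move=> fA; rewrite (cardsD1 f) [#|symdiff F A|](cardsD1 f).
have -> : symdiff F (f |: A) :\ f = symdiff F A :\ f.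
  by apply/setP=> x; rewrite !inE; case: eqP.
by rewrite !in_symdiff !inE eqxx (negPf fA); case: (f \in F) => /=; lia.
Qed.

(** Toggling [u] removes it from the difference, and toggling [v] adds at most one element. *)
Lemma card_symdiff_swap A F u v : u \in symdiff F A ->
  #|symdiff (symdiff F [set u; v]) A| <= #|symdiff F A|.
Proof.
move=> uFA; rewrite [leqRHS](cardsD1 u) uFA.
apply: (@leq_trans #|v |: symdiff F A :\ u|).
  apply/subset_leq_card/subsetP=> x.
  move: uFA; rewrite in_setU1 in_setD1 !in_symdiff in_set2; case: (eqVneq x u) => [->|xu] /=.
    by case: (u \in F); case: (u \in A).
  by case: (x == v); case: (x \in F); case: (x \in A).
by rewrite cardsU1; case: (_ \notin _); lia.
Qed.

(** Away from [f] the ground sets are disjoint, so the differences add up. Since [A1] and [A2] avoid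
    [f], the right side counts [f] once for each of [F1], [F2] containing it, while the glued set
    has lost it. *)
Lemma card_symdiff_glue f G1 G2 A1 A2 F1 F2 :
    G1 :&: G2 = [set f] -> A1 \subset G1 :\ f -> A2 \subset G2 :\ f ->
    F1 \subset G1 -> F2 \subset G2 ->
  #|symdiff ((F1 :|: F2) :\ f) (A1 :|: A2)| + (f \in F1) + (f \in F2)
    = #|symdiff F1 A1| + #|symdiff F2 A2|.
Proof.
move=> G12 A1G A2G F1G F2G.
have fA1 : f \notin A1 by apply/negP=> /(subsetP A1G); rewrite !inE eqxx.
have fA2 : f \notin A2 by apply/negP=> /(subsetP A2G); rewrite !inE eqxx.
have atx x : [&& (x \in A1) ==> (x != f) && (x \in G1),
    (x \in A2) ==> (x != f) && (x \in G2), (x \in F1) ==> (x \in G1),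
    (x \in F2) ==> (x \in G2) & (x \in G1) && (x \in G2) == (x == f)].
  rewrite -!in_setD1 -in_setI G12 inE eqxx andbT.
  by apply/and4P; split; apply/implyP; apply: subsetP.
rewrite [in RHS](cardsD1 f) [#|symdiff F2 A2|](cardsD1 f) !in_symdiff.
rewrite (negPf fA1) (negPf fA2) !addbF.
have -> : symdiff ((F1 :|: F2) :\ f) (A1 :|: A2)
    = symdiff F1 A1 :\ f :|: symdiff F2 A2 :\ f.
  apply/setP=> x; move: (atx x); rewrite !inE; case: eqVneq => [->|_] /=.
    by rewrite (negPf fA1) (negPf fA2).
  case: (x \in A1); case: (x \in A2); case: (x \in F1); case: (x \in F2);
  by case: (x \in G1); case: (x \in G2).
rewrite cardsU (_ : _ :&: _ = set0) ?cards0; first by lia.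
apply/setP=> x; move: (atx x); rewrite !inE; case: eqVneq => //= _.
case: (x \in A1); case: (x \in A2); case: (x \in F1); case: (x \in F2);
by case: (x \in G1); case: (x \in G2).
Qed.

End Symdiff.

(** * Distance from a set to the feasible sets *)

Section Distance.
Local Open Scope nat_scope.
Variable T : finType.
Implicit Types (D : set_system T) (A F G : {set T}) (e f : T).

(** The part of the axioms that is carried through the successive two-sums. *)
Definition proper_system D : Prop :=
  (forall F, F \in feasible D -> F \subset ground D) /\ feasible D != set0.

Lemma dist_le D A F : F \in feasible D -> dist D A <= #|symdiff F A|.
Proof.
rewrite /dist -big_filter => FD.
have: F \in [seq F <- index_enum _ | F \in feasible D].
  by rewrite mem_filter FD mem_index_enum.
elim: {FD}[seq _ <- _ | _] => // G s IHs; rewrite inE big_cons geq_min.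
by case/orP=> [/eqP<-|/IHs->]; rewrite ?leqnn ?orbT.
Qed.

Lemma dist_attained D A : proper_system D -> A \subset ground D ->
  exists2 F, F \in feasible D & #|symdiff F A| = dist D A.
Proof.
move=> [subD /set0Pn[F0 F0D]] AD.
have [//|distD] : (exists2 F, F \in feasible D & #|symdiff F A| = dist D A)
    \/ dist D A = #|ground D|.
  rewrite /dist; apply: (big_ind (fun n => (exists2 F, F \in feasible D
    & #|symdiff F A| = n) \/ n = #|ground D|)); first by right.
    by move=> m n Pm Pn; rewrite /minn; case: ifP.
  by move=> F FD; left; exists F.
(* If the minimum is its default [#|ground D|], every feasible set attains it, since no difference
   of two subsets of the ground set is larger. *)
exists F0 => //; apply/eqP; rewrite eqn_leq dist_le // andbT distD.
apply/subset_leq_card/subsetP=> x; rewrite in_symdiff.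
by case: (boolP (x \in F0)) => [/(subsetP (subD _ F0D))|_ /(subsetP AD)].
Qed.

Lemma dist_eq D A n : proper_system D -> A \subset ground D ->
    (exists2 F, F \in feasible D & #|symdiff F A| = n) ->
    (forall F, F \in feasible D -> n <= #|symdiff F A|) ->
  dist D A = n.
Proof.
move=> okD AD [F FD <-] min; have [F' F'D F'A] := dist_attained okD AD.
by apply/eqP; rewrite eqn_leq dist_le // -F'A min.
Qed.

Lemma delta_matroid_proper D : delta_matroid D -> proper_system D.
Proof. by case. Qed.

(** Neither a loop nor a coloop, with a feasible set on each side of [e] as a partner for
    exchanges. *)
Definition separated D e : Prop :=
  e \in ground D /\ forall b, exists2 F, F \in feasible D & (e \in F) = b.

Lemma nonsingular_separated D e : nonsingular D e -> separated D e.
Proof.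
case/andP=> eD /norP[ncol /norP[nloop _]]; split=> // b.
case: b; move: ncol nloop; rewrite /coloop /loop eD /=.
  by move=> _ /forall_inPn[F FD /negPn eF]; exists F.
by move=> /forall_inPn[F FD /negPf eF] _; exists F.
Qed.

Lemma separated_not_coloop D e : separated D e -> coloop D e = false.
Proof.
case=> eD /(_ false)[F FD eF]; rewrite /coloop eD /=.
by apply/negbTE/forall_inPn; exists F; rewrite ?eF.
Qed.

Lemma separated_not_loop D e : separated D e -> loop D e = false.
Proof.
case=> eD /(_ true)[F FD eF]; rewrite /loop eD /=.
by apply/negbTE/forall_inPn; exists F; rewrite ?eF.
Qed.

(** If a nearest [F] disagrees with [A] at [e], exchange at [e] against a feasible set on the other
    side. The result agrees with [A] at [e], and [card_symdiff_swap] shows that it is no further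
    away. *)
Lemma dist_attained_at D e A b : delta_matroid D -> even_system D ->
    separated D e -> A \subset ground D -> (e \in A) = b ->
  exists F, [/\ F \in feasible D, (e \in F) = b & #|symdiff F A| = dist D A].
Proof.
move=> dmD evenD sepD AD eA.
have okD := delta_matroid_proper dmD.
have [F FD FA] := dist_attained okD AD.
have [eF|neF] := eqVneq (e \in F) b; first by exists F.
have [F' F'D eF'] := proj2 sepD b.
have eFF' : e \in symdiff F F' by rewrite in_symdiff eF' -negb_eqb neF.
case: dmD => _ _ /(_ _ _ _ FD F'D eFF')[v vFF' FuvD].
exists (symdiff F [set e; v]); split=> //.
  rewrite in_symdiff !inE eqxx addbT; apply/eqP; rewrite -[_ == b]negbK.
  by move: neF; case: (e \in F); case: (b).
apply/eqP; rewrite eqn_leq dist_le // andbT -FA card_symdiff_swap //.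
by rewrite in_symdiff eA -negb_eqb neF.
Qed.

(** * Distances in deletions and contractions *)

Section Separated.
Variables (D : set_system T) (e : T).
Hypotheses (dmD : delta_matroid D) (evenD : even_system D).
Hypothesis sepD : separated D e.

Lemma subD1_ground A : A \subset ground D :\ e ->
  [/\ e \notin A, A \subset ground D & e |: A \subset ground D].
Proof.
rewrite subsetD1 => /andP[AD ->]; split=> //.
by rewrite subUset sub1set (proj1 sepD).
Qed.

(** A set nearest to [A] is at most one further from [e |: A], and conversely. Evenness gives the
    two distances different parities, so they are not equal. *)
Lemma dist_add1 A : A \subset ground D :\ e ->
  dist D (e |: A) = (dist D A).+1 \/ dist D A = (dist D (e |: A)).+1.
Proof.
move=> /subD1_ground[eA AD eAD].
have [F [FD eF FA]] := dist_attained_at dmD evenD sepD AD (negPf eA).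
have [F' [F'D eF' F'A]] := dist_attained_at dmD evenD sepD eAD (setU11 e A).
have := card_symdiffU1 F eA; have := card_symdiffU1 F' eA.
have := dist_le A F'D; have := dist_le (e |: A) FD.
have : odd (dist D A) != odd (dist D (e |: A)).
  rewrite -FA -F'A !odd_card_symdiff (evenD FD F'D) cardsU1 eA oddD.
  by case: (odd _); case: (odd _).
rewrite eF eF' -FA -F'A; lia.
Qed.

Lemma delete_proper : proper_system (delete D e).
Proof.
rewrite /delete (separated_not_coloop sepD); split=> /= [F|].
  by rewrite inE subsetD1 => /andP[/(proj1 (delta_matroid_proper dmD))-> ->].
have [F FD eF] := proj2 sepD false.
by apply/set0Pn; exists F; rewrite inE FD eF.
Qed.

(** By [dist_attained_at] some nearest feasible set avoids [e], and it survives the deletion. *)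
Lemma dist_delete A : A \subset ground D :\ e -> dist (delete D e) A = dist D A.
Proof.
move=> AD'; have [eA AD _] := subD1_ground AD'.
have [F [FD eF FA]] := dist_attained_at dmD evenD sepD AD (negPf eA).
apply: dist_eq; rewrite /delete (separated_not_coloop sepD) //=.
- by have := delete_proper; rewrite /delete (separated_not_coloop sepD).
- by exists F; rewrite // inE FD eF.
by move=> G /[!inE] /andP[GD _]; apply: dist_le.
Qed.

Lemma contract_proper : proper_system (contract D e).
Proof.
rewrite /contract (separated_not_loop sepD); split=> /= [F|].
  move=> /imsetP[G /[!inE] /andP[GD _] ->]; apply: setSD.
  exact: (proj1 (delta_matroid_proper dmD)).
have [F FD eF] := proj2 sepD true.
by apply/set0Pn; exists (F :\ e); apply/imsetP; exists F; rewrite ?inE ?FD.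
Qed.

Lemma dist_contract A : A \subset ground D :\ e ->
  dist (contract D e) A = dist D (e |: A).
Proof.
move=> AD'; have [eA _ AD] := subD1_ground AD'.
have [F [FD eF FA]] := dist_attained_at dmD evenD sepD AD (setU11 e A).
(* Dropping [e] from both members of a pair that share it leaves their difference unchanged. *)
have symA (G : {set T}) : e \in G -> symdiff (G :\ e) A = symdiff G (e |: A).
  move=> eG; apply/setP=> x; rewrite !inE.
  by case: eqVneq => [->|//]; rewrite eG (negPf eA).
apply: dist_eq; rewrite /contract (separated_not_loop sepD) //=.
- by have := contract_proper; rewrite /contract (separated_not_loop sepD).
- exists (F :\ e); last by rewrite symA.
  by apply/imsetP; exists F; rewrite ?inE ?FD.
move=> G /imsetP[H /[!inE] /andP[HD eH] ->].
by rewrite symA //; apply: dist_le.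
Qed.

End Separated.

(** * Distances in a two-sum *)

Section TwoSum.
Variables (f : T) (D1 D2 : set_system T).
Hypotheses (okD1 : proper_system D1) (fD1 : f \in ground D1).
Hypotheses (dmD2 : delta_matroid D2) (evenD2 : even_system D2).
Hypotheses (sepD2 : separated D2 f).
Hypothesis D12 : ground D1 :&: ground D2 = [set f].

Lemma two_sum_proper : proper_system (two_sum f D1 D2).
Proof.
case: okD1 => subD1 /set0Pn[F1 F1D]; split=> [F|] /=.
  move=> /imset2P[G1 G2 G1D /[!inE] /andP[G2D _] ->].
  apply/setSD/setUSS; first exact: subD1.
  exact: (proj1 (delta_matroid_proper dmD2)).
have [F2 F2D F2f] := proj2 sepD2 (f \notin F1).
apply/set0Pn; exists ((F1 :|: F2) :\ f); apply/imset2P.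
by exists F1 F2; rewrite // inE F2D F2f; case: (f \in F1).
Qed.

(** By [card_symdiff_glue] a compatible pair costs the sum of its two distances minus one. Hence [f]
    in [F1] amounts to matching [f |: A1] and [A2], and [f] in [F2] to matching [A1] and [f |: A2].
    The nearer side in [D2] decides which match gives the minimum. *)
Lemma dist_two_sum A1 A2 :
    A1 \subset ground D1 :\ f -> A2 \subset ground D2 :\ f ->
  dist (two_sum f D1 D2) (A1 :|: A2) =
    if dist D2 A2 < dist D2 (f |: A2) then dist D2 A2 + dist D1 (f |: A1)
    else dist D2 (f |: A2) + dist D1 A1.
Proof.
move=> A1D A2D; have [fA2 A2D' fA2D] := subD1_ground sepD2 A2D.
have /andP[A1D' fA1]: (A1 \subset ground D1) && (f \notin A1) by rewrite -subsetD1.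
have fA1D : f |: A1 \subset ground D1 by rewrite subUset sub1set fD1.
have [subD1 _] := okD1; have subD2 := proj1 (delta_matroid_proper dmD2).
have near := dist_add1 dmD2 evenD2 sepD2 A2D.
have [F2 [F2D fF2 F2A]] := dist_attained_at dmD2 evenD2 sepD2 A2D' (negPf fA2).
have [G2 [G2D fG2 G2A]] := dist_attained_at dmD2 evenD2 sepD2 fA2D (setU11 f A2).
have cardE F G := card_symdiff_glue D12 A1D A2D (F1 := F) (F2 := G).
have inD F G : F \in feasible D1 -> G \in feasible D2 -> (f \in F) (+) (f \in G) ->
    (F :|: G) :\ f \in feasible (two_sum f D1 D2).
  by move=> FD GD FG; apply/imset2P; exists F G; rewrite // inE GD.
have fD2 := proj1 sepD2.
apply: dist_eq; first exact: two_sum_proper.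
- by rewrite subsetD1 !inE negb_or fA1 fA2 setUSS.
- case: ltnP => lt.
    (* The nearest [F] may lie on either side of [f]. If it misses [f], it is one closer to [A1]
       than to [f |: A1], which pays for the unit lost by taking [G2] instead of [F2]. *)
    have [F FD FA] := dist_attained okD1 fA1D.
    have := card_symdiffU1 F fA1; case fF: (f \in F) => FAf.
      exists ((F :|: F2) :\ f); first by rewrite inD ?fF ?fF2.
      have := cardE F F2 (subD1 _ FD) (subD2 _ F2D); rewrite fF fF2.
      by move: near lt FA FAf F2A G2A; clear; lia.
    exists ((F :|: G2) :\ f); first by rewrite inD ?fF ?fG2.
    have := cardE F G2 (subD1 _ FD) (subD2 _ G2D).
    have := card_symdiffU1 G2 fA2; rewrite fF fG2.
    by move: near lt FA FAf F2A G2A; clear; lia.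
  have [F FD FA] := dist_attained okD1 A1D'.
  have := card_symdiffU1 F fA1; case fF: (f \in F) => FAf.
    exists ((F :|: F2) :\ f); first by rewrite inD ?fF ?fF2.
    have := cardE F F2 (subD1 _ FD) (subD2 _ F2D); rewrite fF fF2.
    by move: near lt FA FAf F2A G2A; clear; lia.
  exists ((F :|: G2) :\ f); first by rewrite inD ?fF ?fG2.
  have := cardE F G2 (subD1 _ FD) (subD2 _ G2D).
  have := card_symdiffU1 G2 fA2; rewrite fF fG2.
  by move: near lt FA FAf F2A G2A; clear; lia.
(* Lower bound for an arbitrary compatible pair, according to which of [F], [G] contains [f]. *)
move=> H /imset2P[F G FD /[!inE] /andP[GD fFG] ->].
have := cardE F G (subD1 _ FD) (subD2 _ GD).
have := card_symdiffU1 F fA1; have := card_symdiffU1 G fA2.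
have := dist_le A1 FD; have := dist_le (f |: A1) FD.
have := dist_le A2 GD; have := dist_le (f |: A2) GD.
by move: fFG; case: (f \in F); case: (f \in G) => //= _; case: ltnP; move: near; clear; lia.
Qed.

End TwoSum.
End Distance.

(** * Invariance under isomorphism *)

Section Isomorphism.
Local Open Scope nat_scope.
Variables (T T' : finType) (D : set_system T) (D' : set_system T').
Variable phi : T -> T'.
Hypothesis isoD : isomorphism D D' phi.
Hypotheses (okD : proper_system D) (okD' : proper_system D').
Implicit Types (A F : {set T}) (e : T).

Lemma iso_card A : A \subset ground D -> #|phi @: A| = #|A|.
Proof.
case: isoD => injphi _ _ AD; apply: card_in_imset => a b aA bA.
by apply: injphi; apply: (subsetP AD).
Qed.

Lemma iso_mem A e : e \in ground D -> A \subset ground D ->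
  (phi e \in phi @: A) = (e \in A).
Proof.
case: isoD => injphi _ _ eD AD; apply/imsetP/idP=> [[a aA]|eA]; last by exists e.
by move/injphi=> -> //; apply: (subsetP AD).
Qed.

Lemma iso_preimage (A' : {set T'}) : A' \subset ground D' ->
  exists2 A : {set T}, A \subset ground D & A' = phi @: A.
Proof.
(* Outside [ground D] the map [phi] is unconstrained and may also hit [A'], hence the
   intersection. *)
case: isoD => _ imD _ A'D'; exists (ground D :&: phi @^-1: A').
  exact: subsetIl.
apply/setP=> y; apply/idP/imsetP=> [yA'|[x /[!inE] /andP[_ xA'] ->//]].
have: y \in ground D' by apply: (subsetP A'D').
rewrite -imD => /imsetP[x xD yE].
by exists x; rewrite // !inE xD -yE.
Qed.

Lemma iso_feasible F : F \in feasible D -> phi @: F \in feasible D'.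
Proof. by case: isoD => _ _ feasE FD; rewrite -feasE // (proj1 okD). Qed.

Lemma iso_feasible_preimage (F' : {set T'}) : F' \in feasible D' ->
  exists2 F : {set T}, F \in feasible D & F' = phi @: F.
Proof.
move=> F'D'; have [F FD F'E] := iso_preimage (proj1 okD' _ F'D').
by exists F => //; case: isoD => _ _ ->; rewrite // -F'E.
Qed.

Lemma iso_symdiff A F : A \subset ground D -> F \subset ground D ->
  phi @: symdiff F A = symdiff (phi @: F) (phi @: A).
Proof.
move=> AD FD; have FAD : symdiff F A \subset ground D.
  by rewrite subUset (subset_trans (subsetDl F A)) ?(subset_trans (subsetDl A F)).
have [_ imD _] := isoD; apply/setP=> y.
have [|yD'] := boolP (y \in phi @: ground D).
  by move=> /imsetP[x xD ->]; rewrite in_symdiff !iso_mem // in_symdiff.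
have notin (B : {set T}) : B \subset ground D -> (y \in phi @: B) = false.
  by move=> BD; apply: contraNF yD'; apply/subsetP/imsetS.
by rewrite in_symdiff !notin.
Qed.

Lemma iso_dist A : A \subset ground D -> dist D A = dist D' (phi @: A).
Proof.
have [injphi imD feasE] := isoD => AD; apply/esym/dist_eq=> //.
- by rewrite -imD imsetS.
- have [F FD <-] := dist_attained okD AD; have FDsub := proj1 okD F FD.
  exists (phi @: F); first exact: iso_feasible.
  rewrite -iso_symdiff // iso_card // subUset.
  by rewrite (subset_trans (subsetDl F A)) ?(subset_trans (subsetDl A F)).
move=> F' /iso_feasible_preimage[F FD ->]; have FDsub := proj1 okD F FD.
rewrite -iso_symdiff // iso_card ?dist_le // subUset.
by rewrite (subset_trans (subsetDl F A)) ?(subset_trans (subsetDl A F)).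
Qed.

Lemma iso_even : even_system D' -> even_system D.
Proof.
move=> evenD' F G FD GD; rewrite -!iso_card ?(proj1 okD) //.
by apply: evenD'; apply: iso_feasible.
Qed.

Lemma iso_separated e : e \in ground D -> separated D' (phi e) -> separated D e.
Proof.
move=> eD [_ sepD']; split=> // b; have [F' F'D' <-] := sepD' b.
have [F FD ->] := iso_feasible_preimage F'D'; exists F => //.
by rewrite iso_mem // (proj1 okD).
Qed.

End Isomorphism.

(** * Transition polynomials of the two minors *)

Section Transition.
Variables (R : comNzRingType) (w x t : R).

(* [near D e true] is the p and [near D e false] the q of the theorem. *)
Definition near (T : finType) (D : set_system T) (e : T) (b : bool) : R :=
  \sum_(A in powerset (ground D :\ e) | (dist D A < dist D (e |: A))%N == b)
     w ^+ #|(ground D :\ e) :\: A| * x ^+ #|A|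
       * t ^+ minn (dist D A) (dist D (e |: A)).

Section Minors.
Variables (T : finType) (D : set_system T) (e : T).
Hypotheses (dmD : delta_matroid D) (evenD : even_system D).
Hypothesis sepD : separated D e.

(** In the contraction [A] has distance [dist D (e |: A)]. This is the minimum used in [near],
    except on the [true] part, where it is one more and yields the factor [t]. *)
Lemma transition_contract :
  transition (contract D e) w x t = t * near D e true + near D e false.
Proof.
have groundE : ground (contract D e) = ground D :\ e.
  by rewrite /contract separated_not_loop.
rewrite /transition /near groundE.
rewrite (bigID (fun A => (dist D A < dist D (e |: A))%N)) /= mulr_sumr.
congr (_ + _); apply: eq_big => [A|A /andP[AD lt]] //;
  rewrite ?eqb_id ?eqbF_neg //.
all: rewrite powersetE in AD; have := dist_add1 dmD evenD sepD AD.
all: rewrite dist_contract //.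
  case=> eqd; first by rewrite eqd (minn_idPl _) // exprS mulrCA.
  by rewrite eqd ltnNge leqnSn in lt.
by case=> eqd; [rewrite eqd leqnn in lt|rewrite eqd (minn_idPr _)].
Qed.

Lemma transition_delete :
  transition (delete D e) w x t = near D e true + t * near D e false.
Proof.
have groundE : ground (delete D e) = ground D :\ e.
  by rewrite /delete separated_not_coloop.
rewrite /transition /near groundE.
rewrite (bigID (fun A => (dist D A < dist D (e |: A))%N)) /= mulr_sumr.
congr (_ + _); apply: eq_big => [A|A /andP[AD lt]] //;
  rewrite ?eqb_id ?eqbF_neg //.
all: rewrite powersetE in AD; have := dist_add1 dmD evenD sepD AD.
all: rewrite dist_delete //.
  by case=> eqd; [rewrite eqd (minn_idPl _)|rewrite eqd ltnNge leqnSn in lt].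
case=> eqd; first by rewrite eqd leqnn in lt.
by rewrite eqd (minn_idPr _) // exprS mulrCA.
Qed.

End Minors.

(** Ensures that all the copies of [D2] in a tensor product contribute the same pair of weights. *)
Lemma iso_near (T T' : finType) (D : set_system T) (D' : set_system T')
    (phi : T -> T') (e : T) (b : bool) :
    isomorphism D D' phi -> proper_system D -> proper_system D' ->
    e \in ground D ->
  near D e b = near D' (phi e) b.
Proof.
move=> isoD okD okD' eD; have [injphi imD _] := isoD.
have imD1 (A : {set T}) : A \subset ground D :\ e -> phi @: (ground D :\ e :\: A)
    = ground D' :\ phi e :\: phi @: A.
  rewrite -imD => AD1; have AD := subset_trans AD1 (subsetDl _ _).
  apply/setP=> y; have [|yD] := boolP (y \in phi @: ground D).
    move=> /imsetP[a aD ->]; rewrite !inE !(iso_mem isoD) //; last first.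
      exact: subset_trans (subsetDl _ _) (subsetDl _ _).
    by rewrite !inE aD (inj_in_eq injphi) // imset_f.
  rewrite !inE (negPf yD) !andbF; apply/negP=> /imsetP[a] /[!inE] /and3P[_ _ aD] yE.
  by rewrite yE imset_f in yD.
(* The sum over subsets of [ground D' :\ phi e] is reindexed by images. Taking images is injective
   on subsets of [ground D], because [phi] is injective there. *)
have powE : powerset (ground D' :\ phi e)
    = [set phi @: (A : {set T}) | A in powerset (ground D :\ e)].
  apply/setP=> A'; rewrite powersetE; apply/idP/imsetP=> [A'D'|[A]].
    have [A AD A'E] := iso_preimage isoD (subset_trans A'D' (subsetDl _ _)).
    exists A; rewrite // powersetE subsetD1 AD -(iso_mem isoD) // -A'E.
    by move: A'D'; rewrite subsetD1 => /andP[].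
  rewrite powersetE !subsetD1 => /andP[AD eA] ->.
  by rewrite -imD imsetS //= (iso_mem isoD).
rewrite /near powE big_imset_cond /=; last first.
  move=> A B; rewrite !powersetE !subsetD1 => /andP[AD _] /andP[BD _] AB.
  apply/setP=> a; have [aD|aD] := boolP (a \in ground D).
    by rewrite -(iso_mem isoD aD AD) AB (iso_mem isoD aD BD).
  by rewrite !(contraNF (subsetP _ a) aD).
have distE (A : {set T}) : A \subset ground D :\ e -> (dist D A = dist D' (phi @: A)) *
    (dist D (e |: A) = dist D' (phi e |: phi @: A)).
  move=> AD1; have AD := subset_trans AD1 (subsetDl _ _).
  by rewrite -imsetU1 -!(iso_dist isoD) // subUset sub1set eD.
apply: eq_big => [A|A /andP[AD _]].
  by case: (boolP (A \in _)) => //; rewrite powersetE => /distE[-> ->].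
rewrite powersetE in AD; have [-> ->] := distE A AD; rewrite -imD1 // !(iso_card isoD) //.
  exact: subset_trans AD (subsetDl _ _).
exact: subset_trans (subsetDl _ _) (subsetDl _ _).
Qed.

(** * Transition sums with individual weights *)

Section Weighted.
Variable T : finType.
Implicit Types (D : set_system T) (A B G H : {set T}) (u v : T -> R).

(** Weights depend on the element so that some elements can carry [near] values while the others
    still carry [w] and [x]. *)
Definition weight G u v A : R := \prod_(g in G) (if g \in A then v g else u g).

Definition weighted_transition D u v : R :=
  \sum_(A in powerset (ground D)) weight (ground D) u v A * t ^+ dist D A.

Lemma eq_weighted_transition D u v u' v' :
    {in ground D, u =1 u'} -> {in ground D, v =1 v'} ->
  weighted_transition D u v = weighted_transition D u' v'.
Proof.
move=> uE vE; apply: eq_bigr => A _; congr (_ * _).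
by apply: eq_bigr => g gD; rewrite uE ?vE.
Qed.

Lemma weight_const G u v A a b : A \subset G ->
    {in G, forall g, u g = a} -> {in G, forall g, v g = b} ->
  weight G u v A = a ^+ #|G :\: A| * b ^+ #|A|.
Proof.
move=> AG uE vE; rewrite /weight (bigID (mem A)) /= mulrC; congr (_ * _).
  rewrite -prodr_const; apply: eq_big => [g|g /andP[gG /negPf->]]; last exact: uE.
  by rewrite inE andbC.
rewrite -prodr_const; apply: eq_big => [g|g /andP[gG ->]]; last exact: vE.
by case: (boolP (g \in A)) => [/(subsetP AG)->|]; rewrite ?andbF.
Qed.

Lemma weighted_transition_const D u v a b :
    {in ground D, forall g, u g = a} -> {in ground D, forall g, v g = b} ->
  weighted_transition D u v = transition D a b t.
Proof.
by move=> uE vE; apply: eq_bigr => A /[!powersetE] AD; rewrite (weight_const AD uE vE).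
Qed.

Lemma weightU G H u v A B : [disjoint G & H] -> A \subset G -> B \subset H ->
  weight (G :|: H) u v (A :|: B) = weight G u v A * weight H u v B.
Proof.
move=> disjGH AG BH; rewrite /weight.
rewrite (eq_bigl [predU G & H]) => [|g]; last by rewrite inE.
rewrite bigU //; congr (_ * _); apply: eq_bigr => g gG; rewrite inE.
  by rewrite (contraFF (subsetP BH g)) ?orbF // (disjointFr disjGH).
by rewrite (contraFF (subsetP AG g)) // (disjointFl disjGH).
Qed.

Lemma sum_powersetU G H (F : {set T} -> R) : [disjoint G & H] ->
  \sum_(A in powerset (G :|: H)) F A =
    \sum_(A in powerset G) \sum_(B in powerset H) F (A :|: B).
Proof.
move=> disjGH; rewrite pair_big /=.
rewrite (reindex_onto (fun A : {set T} * {set T} => A.1 :|: A.2)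
  (fun A => (A :&: G, A :&: H))) /=; last first.
  by move=> A; rewrite powersetE => AGH; rewrite -setIUr; apply/setIidPl.
apply: eq_bigl => [[A B]] /=; rewrite !powersetE xpair_eqE.
apply/idP/idP=> [/and3P[_ /eqP<- /eqP<-]|/andP[AG BH]]; first by rewrite !subsetIr.
rewrite setUSS //= !setIUl (setIidPl AG) (setIidPl BH).
have [-> ->] : B :&: G = set0 /\ A :&: H = set0.
  split; apply/eqP; rewrite setI_eq0.
    by rewrite disjoint_sym (disjointWr BH).
  exact: disjointWl AG disjGH.
by rewrite setU0 set0U !eqxx.
Qed.

(** For a fixed [A1], [dist_two_sum] splits the sum over [A2] into [near D2 f false] times the power
    of [t] for [A1] and [near D2 f true] times that for [f |: A1]. These are the two terms of [D1]
    that extend [A1] at [f]. *)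
Lemma weighted_transition_two_sum f D1 D2 u v :
    proper_system D1 -> f \in ground D1 -> delta_matroid D2 ->
    even_system D2 -> separated D2 f -> ground D1 :&: ground D2 = [set f] ->
    {in ground D2 :\ f, forall g, u g = w} ->
    {in ground D2 :\ f, forall g, v g = x} ->
  weighted_transition (two_sum f D1 D2) u v =
    weighted_transition D1 (fun g => if g == f then near D2 f false else u g)
                           (fun g => if g == f then near D2 f true else v g).
Proof.
move=> okD1 fD1 dmD2 evenD2 sepD2 D12 uE vE.
have disj12 : [disjoint ground D1 :\ f & ground D2 :\ f].
  by rewrite -setI_eq0 -setDIl D12 setDv.
have disjf : [disjoint ground D1 :\ f & [set f]].
  by rewrite disjoint_sym disjoints1 !inE eqxx.
rewrite /weighted_transition /= setDUl sum_powersetU //.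
rewrite -[in RHS](setD1K fD1) [f |: _]setUC sum_powersetU //.
apply: eq_bigr => A1; rewrite powersetE => A1D.
have fA1 : f \notin A1 by move: A1D; rewrite subsetD1 => /andP[].
rewrite powerset1 big_setU1 ?big_set1 /=; last first.
  by rewrite inE eq_sym -card_gt0 cards1.
rewrite [in RHS]weightU ?sub0set // [in RHS]weightU // setU0 [A1 :|: [set f]]setUC.
set u' := fun g : T => if _ then near D2 f false else _.
set v' := fun g : T => if _ then near D2 f true else _.
have weight1 : weight (ground D1 :\ f) u' v' A1 = weight (ground D1 :\ f) u v A1.
  by apply: eq_bigr => g; rewrite /u' /v' in_setD1 => /andP[/negPf->].
have weight0 : weight [set f] u' v' set0 = near D2 f false.
  by rewrite /weight big_set1 inE /u' eqxx.
have weightf : weight [set f] u' v' [set f] = near D2 f true.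
  by rewrite /weight big_set1 inE /v' eqxx.
rewrite weight1 weight0 weightf.
under eq_bigr => A2 /[!powersetE] A2D.
  rewrite weightU // (weight_const A2D uE vE) dist_two_sum //.
  over.
(* The swap puts the [false] part first, matching the order [set0], [[set f]] on the right. *)
rewrite (bigID (fun A2 => (dist D2 A2 < dist D2 (f |: A2))%N)) /= addrC.
rewrite /near !mulr_sumr !mulr_suml.
congr (_ + _); apply: eq_big => [A|A /andP[AD lt]] //;
  rewrite ?eqb_id ?eqbF_neg //.
  have ge := lt; rewrite -leqNgt in ge.
  by rewrite (negPf lt) (minn_idPr ge) exprD !mulrA.
by rewrite lt (minn_idPl (ltnW lt)) exprD !mulrA.
Qed.

(** Induction on [s] for all [D1]: the hypothesis is applied to the two-sum with the first copy, and
    the previous lemma then absorbs that copy into the weights of its element. *)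
Lemma transition_foldl_two_sum (Df : T -> set_system T) (c : bool -> R) s D1 :
    proper_system D1 -> uniq s -> {subset s <= ground D1} ->
    {in s, forall f, [/\ delta_matroid (Df f), even_system (Df f),
       separated (Df f) f, ground D1 :&: ground (Df f) = [set f]
     & near (Df f) f =1 c]} ->
    {in s &, forall f g, f != g -> [disjoint ground (Df f) & ground (Df g)]} ->
  transition (foldl (fun D f => two_sum f D (Df f)) D1 s) w x t =
    weighted_transition D1 (fun g => if g \in s then c false else w)
                           (fun g => if g \in s then c true else x).
Proof.
elim: s D1 => [|f s IHs] D1 okD1 /=.
  by move=> *; rewrite (weighted_transition_const (a := w) (b := x)).
move=> /andP[fs uniqs] sD1 sDf disjDf.
have [dmf evenf sepf D1f nearf] := sDf f (mem_head f s).
have fD1 : f \in ground D1 by rewrite sD1 ?mem_head.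
have sD1' g : g \in s -> g \in ground D1 by move=> gs; rewrite sD1 // inE gs orbT.
have neqf g : g \in s -> g != f by apply: contraTneq => ->.
(* The new elements of [Df f] lie outside [ground D1], hence outside [s], so they keep the weights
   [w] and [x]. *)
have notin g : g \in ground (Df f) :\ f -> (g \in s) = false.
  rewrite inE => /andP[gf gDf]; apply: contraNF gf => /sD1' gD1.
  by have /setP/(_ g) := D1f; rewrite !inE gD1 gDf => <-.
rewrite IHs //; first 1 last.
- exact: two_sum_proper.
- by move=> g gs; rewrite !inE (neqf g gs) (sD1' g gs).
- move=> g gs; have gfs : g \in f :: s by rewrite inE gs orbT.
  have [dmg eveng sepg D1g nearg] := sDf g gfs; split=> //.
  (* The enlarged ground set still meets that of [Df g] only in [g], because the copies [Df f] and
     [Df g] are disjoint. *)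
  rewrite /= setIDAC setIUl D1g (_ : _ :&: _ = set0).
    rewrite setU0; apply/setP=> a; rewrite !inE.
    by case: (eqVneq a g) => [->|]; rewrite ?andbF // neqf.
  by apply/eqP; rewrite setI_eq0 disjDf ?mem_head // eq_sym neqf.
- by move=> g h gs hs; apply: disjDf; rewrite inE ?gs ?hs orbT.
rewrite weighted_transition_two_sum //; try by move=> g /notin->.
by apply: eq_weighted_transition => g _ /=; rewrite inE;
  case: eqVneq => [->|]; rewrite ?nearf.
Qed.

End Weighted.
End Transition.

(** * The linear system and the tensor product *)

Lemma var_t_sqr_neq1 : var_t ^+ 2 - 1 != 0.
Proof.
(* At the origin this polynomial, the determinant of the system, takes the value -1. *)
apply/eqP=> /(congr1 (meval (fun=> 0 : int))).
by rewrite expr2 mevalB mevalM mevalXU meval1 meval0 mul0r sub0r.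
Qed.

Lemma two_by_two_unique (R : idomainType) (t p q p' q' : R) : t ^+ 2 - 1 != 0 ->
  t * p + q = t * p' + q' -> p + t * q = p' + t * q' -> p' = p /\ q' = q.
Proof.
move=> t_neq eq1 eq2.
have eqp : (t ^+ 2 - 1) * (p' - p) = 0.
  (* Elimination of [q]: [t] times the first equation minus the second. *)
  have -> : (t ^+ 2 - 1) * (p' - p) = t * ((t * p' + q') - (t * p + q))
     - ((p' + t * q') - (p + t * q)) by ring.
  by rewrite eq1 eq2 !subrr mulr0 subr0.
move/eqP: eqp; rewrite mulf_eq0 (negPf t_neq) subr_eq0 => /eqP pE.
by split=> //; move: eq1; rewrite pE => /addrI.
Qed.

Theorem theorem27 (T T2 : finType) (D1 : set_system T) (D2 : set_system T2)
    (e : T2)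
    (D1_dm : delta_matroid D1) (D1_even : even_system D1)
    (D1_ns : forall f, f \in ground D1 -> ~~ singular D1 f)
    (D2_dm : delta_matroid D2) (D2_even : even_system D2)
    (e_ns : nonsingular D2 e) :
  exists p q : {mpoly int[3]},
    [/\ transition (contract D2 e) var_w var_x var_t = var_t * p + q
          /\ transition (delete D2 e) var_w var_x var_t = p + var_t * q,
        forall p' q' : {mpoly int[3]},
          transition (contract D2 e) var_w var_x var_t = var_t * p' + q' ->
          transition (delete D2 e) var_w var_x var_t = p' + var_t * q' ->
          p' = p /\ q' = q
      & forall D : set_system T, tensor_product D1 D2 e D ->
          transition D var_w var_x var_t = transition D1 q p var_t].
Proof.
set near2 := near var_w var_x var_t D2 e.
have sepD2 := nonsingular_separated e_ns.
have contractE := transition_contract var_w var_x var_t D2_dm D2_even sepD2.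
have deleteE := transition_delete var_w var_x var_t D2_dm D2_even sepD2.
exists (near2 true), (near2 false); split=> [//|p' q'|D].
  rewrite contractE deleteE; apply: two_by_two_unique; exact: var_t_sqr_neq1.
case=> Df [s [DfP disjDf sE ->]].
have memE f : (f \in s) = (f \in ground D1) by rewrite (perm_mem sE) mem_enum.
have okD1 := delta_matroid_proper D1_dm.
have okD2 := delta_matroid_proper D2_dm.
rewrite (transition_foldl_two_sum (c := near2) okD1).
(* As [s] exhausts [ground D1], every element has been replaced and the weights are constant. *)
- by apply: weighted_transition_const => f /=; rewrite memE => ->.
- by rewrite (perm_uniq sE) enum_uniq.
- by move=> f; rewrite memE.
- move=> f; rewrite memE => fD1; have [dmf Df1 [phi isof phif]] := DfP f fD1.
  have okf := delta_matroid_proper dmf.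
  have ff : f \in ground (Df f).
    by have := set11 f; rewrite -Df1 inE => /andP[].
  (* Evenness, separation at [f] and the [near] values come from [D2] through the isomorphism. *)
  split=> //.
  + exact: iso_even isof okf D2_even.
  + by apply: (iso_separated isof okf okD2 ff); rewrite phif.
  by move=> b; rewrite (iso_near _ _ _ _ isof okf okD2 ff) phif.
by move=> f g; rewrite !memE; apply: disjDf.
Qed.
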